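(* Let $\nu\ge 0$. The type 1 multiple orthogonal polynomials for the pair $(\rho_\nu,\rho_{\nu+1})$ are given by the following Rodrigues formula: with a suitable choice of the free nonzero multiplicative constants in the type 1 functions $q_{n,n-1}^{\alpha}$ and $q_{n,n}^{\alpha}$, one has for every real $\alpha>-1$, every integer $n\ge 0$ and all $x>0$ $$\frac{d^{2n}}{dx^{2n}}\left(x^{2n+\alpha}\rho_\nu(x)\right)=x^{\alpha}q_{n,n-1}^{\alpha}(x),\qquad \frac{d^{2n+1}}{dx^{2n+1}}\left(x^{2n+1+\alpha}\rho_\nu(x)\right)=x^{\alpha}q_{n,n}^{\alpha}(x).$$
   Context: $K_\nu$ is the Macdonald function (modified Bessel function of the second kind), given for $z>0$ by $K_\nu(z)=\frac12\left(\frac z2\right)^{\nu}\int_0^\infty \exp\left(-t-\frac{z^2}{4t}\right)t^{-\nu-1}\,dt$. For $x>0$ the scaled Macdonald function is $\rho_\nu(x)=2x^{\nu/2}K_\nu(2\sqrt{x})$. Throughout $\nu\ge 0$. For $\alpha>-1$ and indices $n\ge 0$, $m\in\{n,n-1\}$, the type 1 multiple orthogonal polynomials for the pair of weights $(\rho_\nu,\rho_{\nu+1})$ are a pair $(A_{n,m}^{\alpha},B_{n,m}^{\alpha})\neq(0,0)$ of polynomials of degrees (at most) $n$ and $m$ respectively such that $$\int_0^\infty\left[A_{n,m}^{\alpha}(x)\rho_\nu(x)+B_{n,m}^{\alpha}(x)\rho_{\nu+1}(x)\right]x^{k+\alpha}\,dx=0,\qquad k=0,1,2,\ldots,n+m.$$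 For these indices the pair is unique up to a common nonzero constant factor. The type 1 function is $$q_{n,m}^{\alpha}(x)=A_{n,m}^{\alpha}(x)\rho_\nu(x)+B_{n,m}^{\alpha}(x)\rho_{\nu+1}(x).$$ For $(n,m)=(0,-1)$ the convention is $B_{0,-1}^{\alpha}=0$, $A_{0,-1}^{\alpha}$ is a nonzero constant, and there are no orthogonality conditions, so $q_{0,-1}^{\alpha}$ is a nonzero constant multiple of $\rho_\nu$. *)

(* Defs.v *)
From mathcomp Require Import all_boot all_order all_algebra.
From mathcomp Require Import all_classical all_reals all_analysis.
Import Order.TTheory GRing.Theory Num.Theory.
Import numFieldNormedType.Exports.

Set Implicit Arguments.
Unset Strict Implicit.
Unset Printing Implicit Defensive.

Local Open Scope classical_set_scope.
Local Open Scope ring_scope.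

(* The Macdonald function; it is only meant for z > 0, where the integral
   converges for every real nu. *)
Definition macdonaldK (R : realType) (nu z : R) : R :=
  2^-1 * (z / 2) `^ nu *
  \int[@lebesgue_measure R]_(t in `]0, +oo[)
    (expR (- t - z ^+ 2 / (4 * t)) * t `^ (- nu - 1)).

Definition rho (R : realType) (nu x : R) : R :=
  2 * x `^ (nu / 2) * macdonaldK nu (2 * Num.sqrt x).

Definition type1_fun (R : realType) (nu : R) (A B : {poly R}) (x : R) : R :=
  A.[x] * rho nu x + B.[x] * rho (nu + 1) x.

(* The index m is an integer so that m = -1 is allowed; since size is
   degree + 1, the bound on B then says B = 0. The integrability clause
   excludes a meaningless value 0 of the (total) Lebesgue integral. *)
Definition is_type1_pair (R : realType) (nu alpha : R) (n : nat) (m : int)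
    (A B : {poly R}) : Prop :=
  [/\ (A, B) <> (0, 0),
      (size A <= n.+1)%N,
      (size B)%:Z <= m + 1
    & forall k : nat, k%:Z <= n%:Z + m ->
        let f x := type1_fun nu A B x * x `^ (k%:R + alpha) in
        (@lebesgue_measure R).-integrable `]0, +oo[ (EFin \o f) /\
        \int[@lebesgue_measure R]_(x in `]0, +oo[) f x = 0 ].

(* On ]0, +oo[ the k-th derivative of f exists and equals g. As derive1n is
   total, the existence of the successive derivatives is required explicitly. *)
Definition is_derive1n_gt0 (R : realType) (k : nat) (f g : R -> R) : Prop :=
  forall x : R, 0 < x ->
    (forall j : nat, (j < k)%N -> derivable (derive1n j f) x 1) /\
    derive1n k f x = g x.

(* Main.v *)
Require Import Defs.
From mathcomp Require Import all_boot all_order all_algebra.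
From mathcomp Require Import all_classical all_reals all_analysis.
From mathcomp Require Import measurable_realfun zify ring lra.
Import Order.TTheory GRing.Theory Num.Theory.
Import numFieldNormedType.Exports.
Set Implicit Arguments.
Unset Strict Implicit.
Unset Printing Implicit Defensive.
Local Open Scope classical_set_scope.
Local Open Scope ring_scope.

(** Write the type 1 function as a pair of polynomials [(A, B)] standing for
    [A rho_nu + B rho_{nu+1}].  Two facts about the weights carry everything.

    Differentiation.  From [rho_nu(x) = x^nu int exp(-t-x/t) t^(-nu-1) dt]
    ([rhoE]) one gets [x rho_nu' = nu rho_nu - rho_{nu+1}] and
    [rho_{nu+1}' = - rho_nu] ([is_derive_rho], [is_derive_rhoS]).  Hence the
    derivative of [x^a (A rho_nu + B rho_{nu+1})] is [x^(a-1)] times a function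
    of the same form, with a new pair given by the explicit [rodrigues_step].
    Iterating from [(1, 0)] shows that the left-hand sides of the Rodrigues
    formula are [x^alpha] times a type 1 form, whose degrees are read off the
    recurrence.

    Moments.  By Tonelli, [int x^(s-1) rho_nu dx = Gamma(s) Gamma(s+nu)]
    ([ge0_integral_moment]).  The functional equation of Gamma then turns the
    moment of order [s] of [(A, B)] into [Gamma(s) Gamma(s+nu)] times the value
    at [s] of a polynomial [mellin (A, B)] ([moment_type1]), so that
    orthogonality to [x^(k+alpha)] says that [k+alpha+1] is a root of it
    ([type1_orthogonal_iff]).  On that side [rodrigues_step a] is
    multiplication by [a - s] ([mellin_step]), the algebraic shadow of an
    integration by parts.  The Rodrigues pair of order [N] thus has symbol
    [prod_{k<N} (k+alpha+1 - s)], which vanishes at all the required points: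
    this is existence.

    Uniqueness.  [mellin] expands [A] in monic polynomials of degrees
    [0, 2, 4, ...] and [B] in monic polynomials of degrees [1, 3, 5, ...], so it
    is injective, and the degree bounds on [A] and [B] say exactly that the
    symbol has degree at most [N = n + m + 1].  A nonzero symbol with [N]
    prescribed roots is a multiple of the one above, and injectivity brings the
    proportionality back to the pairs ([rodrigues_unique]). *)

(** * Integration over the positive half-line *)

Section HalfLine.
Context {R : realType}.
Notation mu := (@lebesgue_measure R).
Notation halfline := (`]0%R, +oo[%classic : set R).

(** Compact intervals filling the open half-line. The shift by 2 makes each of
    them nondegenerate, as needed by the fundamental theorem of calculus. *)
Definition exhaust (n : nat) : set R := `[n.+2%:R^-1, n.+2%:R].

Lemma exhaust_bounds_lt (n : nat) : (n.+2%:R^-1 : R) < n.+2%:R.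
Proof.
have h : (1 : R) < n.+2%:R by rewrite ltr1n.
by rewrite (lt_trans _ h)// invf_lt1// (lt_trans _ h).
Qed.

Lemma exhaust_gt0 n x : exhaust n x -> 0 < x.
Proof.
by rewrite /exhaust /= in_itv/= => /andP[+ _]; apply: lt_le_trans; rewrite invr_gt0.
Qed.

Lemma exhaust_nondecreasing : nondecreasing_seq exhaust.
Proof.
move=> m n mn; rewrite subsetEset => x; rewrite /exhaust /= !in_itv/=.
move=> /andP[mx xm]; apply/andP; split.
  by rewrite (le_trans _ mx)// lef_pV2 ?posrE// ler_nat.
by rewrite (le_trans xm)// ler_nat.
Qed.

Lemma exhaust_near (x : R) : 0 < x -> \forall n \near \oo, exhaust n x.
Proof.
move=> x0; near=> n; rewrite /exhaust /= in_itv/=; apply/andP; split.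
  rewrite invf_ple ?posrE//.
  near: n; exists (Num.truncn x^-1) => // n /= hn.
  by rewrite (le_trans (ltW (truncnS_gt _)))// ler_nat ltnS (leq_trans hn).
near: n; exists (Num.truncn x) => // n /= hn.
by rewrite (le_trans (ltW (truncnS_gt _)))// ler_nat ltnS (leq_trans hn).
Unshelve. all: end_near. Qed.

Lemma bigcup_exhaust : \bigcup_n exhaust n = halfline.
Proof.
apply/seteqP; split => x /=.
  by move=> [n _ /exhaust_gt0]; rewrite in_itv/= andbT.
rewrite in_itv/= andbT => /exhaust_near[n _ /(_ n (leqnn n))].
by exists n.
Qed.

Lemma halflineP (x : R) : halfline x <-> 0 < x.
Proof. by rewrite /= in_itv/= andbT. Qed.

Lemma measurable_fun_halfline (f : R -> R) :
  (forall x : R, 0 < x -> {for x, continuous f}) ->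
  measurable_fun halfline f.
Proof.
move=> cf; apply: open_continuous_measurable_fun; first exact: interval_open.
by move=> x; rewrite inE => /halflineP; exact: cf.
Qed.

Lemma integrable_halflineZ (c : R) (f : R -> R) :
  mu.-integrable halfline (EFin \o f) ->
  mu.-integrable halfline (EFin \o (fun x => c * f x)).
Proof. by move=> intf; apply: (integrableZl _ c intf); exact: measurable_itv. Qed.

Lemma integrable_halflineD (f g : R -> R) :
  mu.-integrable halfline (EFin \o f) -> mu.-integrable halfline (EFin \o g) ->
  mu.-integrable halfline (EFin \o (fun x => f x + g x)).
Proof. by move=> intf intg; apply: (integrableD _ intf intg); exact: measurable_itv. Qed.

Lemma integrable_halflineB (f g : R -> R) :
  mu.-integrable halfline (EFin \o f) -> mu.-integrable halfline (EFin \o g) ->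
  mu.-integrable halfline (EFin \o (fun x => f x - g x)).
Proof. by move=> intf intg; apply: (integrableB _ intf intg); exact: measurable_itv. Qed.

Lemma eq_integrable_halfline (f g : R -> R) : (forall x : R, 0 < x -> f x = g x) ->
  mu.-integrable halfline (EFin \o f) -> mu.-integrable halfline (EFin \o g).
Proof.
move=> fg; apply: eq_integrable; first exact: measurable_itv.
by move=> x; rewrite inE => /halflineP x0; rewrite /= fg.
Qed.

Lemma eq_Rintegral_halfline (f g : R -> R) : (forall x : R, 0 < x -> f x = g x) ->
  \int[mu]_(x in halfline) f x = \int[mu]_(x in halfline) g x.
Proof. by move=> fg; apply: eq_Rintegral => x; rewrite inE => /halflineP /fg. Qed.

Section FTC.
Variables f F : R -> R.
Hypothesis cf : forall x : R, 0 < x -> {for x, continuous f}.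
Hypothesis dF : forall x : R, 0 < x -> is_derive x (1 : R) F (f x).

Let mf : measurable_fun halfline f.
Proof. exact: measurable_fun_halfline. Qed.

Lemma continuous_primitive (x : R) : 0 < x -> {for x, continuous F}.
Proof.
move=> x0; apply: differentiable_continuous; apply/derivable1_diffP.
by have [] := dF x0.
Qed.

Lemma within_exhaust (g : R -> R) n :
  (forall x : R, 0 < x -> {for x, continuous g}) -> {within exhaust n, continuous g}.
Proof.
move=> cg; apply/continuous_in_subspaceT => x; rewrite inE.
by move=> /exhaust_gt0; exact: cg.
Qed.

(** The integrands below may blow up at 0, so the fundamental theorem is only
    available away from 0; improper integrals are reached by exhaustion. *)
Lemma FTC_exhaust n : (\int[mu]_(x in exhaust n) (f x)%:E =
  (F n.+2%:R)%:E - (F n.+2%:R^-1)%:E)%E.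
Proof.
apply: continuous_FTC2; first exact: exhaust_bounds_lt.
- exact: within_exhaust.
- split.
  + move=> x; rewrite in_itv/= => /andP[nx _].
    by have [] := dF (lt_trans _ nx); rewrite ?invr_gt0//.
  + by apply: cvg_at_right_filter; apply: continuous_primitive.
  + by apply: cvg_at_left_filter; apply: continuous_primitive.
- move=> x; rewrite in_itv/= => /andP[nx _].
  rewrite derive1E; apply: derive_val; apply: dF.
  by rewrite (lt_trans _ nx)// invr_gt0.
Qed.

(** Monotone convergence along the exhaustion: the integrals over the compact
    pieces are increments of the primitive, hence at most twice its bound. *)
Lemma integrable_of_bounded_primitive (C : R) :
  (forall x : R, 0 < x -> 0 <= f x) -> (forall x : R, 0 < x -> `|F x| <= C) ->
  mu.-integrable halfline (EFin \o f).
Proof.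
move=> f0 FC; apply/integrableP; split; first exact/measurable_EFinP.
have -> : (\int[mu]_(x in halfline) `|(EFin \o f) x| =
           \int[mu]_(x in halfline) (f x)%:E)%E.
  apply: eq_integral => x; rewrite inE => /halflineP x0.
  by rewrite /= ger0_norm// f0.
have cvg : (\int[mu]_(x in exhaust n) (f x)%:E @[n --> \oo] -->
            \int[mu]_(x in \bigcup_n exhaust n) (f x)%:E)%E.
  apply: ge0_nondecreasing_set_cvg_integral => //.
  - exact: exhaust_nondecreasing.
  - by move=> n; exact: measurable_itv.
  - move=> n; apply: (measurable_funS _ _ (measurableT_comp _ mf)) => //.
    by move=> x /exhaust_gt0 /halflineP.
  - by move=> n x /exhaust_gt0 x0; rewrite lee_fin f0.
rewrite bigcup_exhaust in cvg.
apply: (@le_lt_trans _ _ (C + C)%:E); last exact: ltry.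
rewrite -(cvg_lim _ cvg)//.
apply: lime_le; first by apply/cvg_ex; eexists; exact: cvg.
apply: nearW => n; rewrite FTC_exhaust -EFinB lee_fin (le_trans (ler_norm _))//.
by rewrite (le_trans (ler_normB _ _))// lerD// FC// invr_gt0.
Qed.

(** Dominated convergence, with the absolute value of the integrand as the
    dominating function. *)
Lemma integral_exhaust_cvg (g : R -> R) : mu.-integrable halfline (EFin \o g) ->
  (\int[mu]_(x in exhaust n) (g x)%:E @[n --> \oo] -->
   \int[mu]_(x in halfline) (g x)%:E)%E.
Proof.
move=> ig.
have sub n : exhaust n `<=` halfline by move=> x /exhaust_gt0 /halflineP.
have -> : (fun n => \int[mu]_(x in exhaust n) (g x)%:E)%E =
   (fun n => \int[mu]_(x in halfline) ((EFin \o g) \_ (exhaust n)) x)%E.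
  by apply/funext => n; rewrite -integral_mkcondr setIidr.
apply: (@dominated_cvg _ _ _ mu _ _ _ _ (abse \o (EFin \o g))) => //.
- move=> n.
  have mg : measurable_fun halfline (EFin \o g) by exact: measurable_int ig.
  apply/measurable_restrict => //; first exact: measurable_itv.
  by apply: measurable_funS mg => //; exact: subIsetl.
- move=> x /halflineP x0; apply: cvg_near_cst.
  near=> n; rewrite patchE mem_set//.
  by near: n; exact: exhaust_near.
- exact: integrable_abse.
- move=> n x _ /=; rewrite patchE; case: ifPn => // _.
  by rewrite abse0.
Unshelve. all: end_near. Qed.

(** The form in which integrations by parts are used: the integral of an exact
    derivative vanishes when the primitive tends to 0 at both ends. *)
Lemma integral_deriv_eq0 :
  mu.-integrable halfline (EFin \o f) ->
  F x @[x --> 0^'+] --> (0 : R) -> F x @[x --> +oo] --> (0 : R) ->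
  \int[mu]_(x in halfline) f x = 0.
Proof.
move=> intf F0 Foo.
have h := integral_exhaust_cvg intf.
suff h0 : (\int[mu]_(x in exhaust n) (f x)%:E @[n --> \oo] --> 0%E)%E.
  by rewrite /Rintegral (cvg_unique _ h h0).
under eq_fun do rewrite FTC_exhaust -EFinB.
apply: cvg_EFin; first exact: nearW.
rewrite -[0]subr0; apply: cvgB.
- apply: (cvg_comp _ _ _ Foo); apply/cvgryPge => A.
  near=> n; near: n; exists (Num.truncn A) => // n /= hn.
  by rewrite (le_trans (ltW (truncnS_gt _)))// ler_nat ltnS (leq_trans hn).
- move/cvg_at_rightP: F0; apply; split; first by move=> n; rewrite invr_gt0.
  apply/cvgrPdist_lt => e e0; near=> n; rewrite sub0r normrN gtr0_norm ?invr_gt0//.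
  rewrite invf_plt ?posrE//.
  near: n; exists (Num.truncn e^-1) => // n /= hn.
  by rewrite (lt_le_trans (truncnS_gt _))// ler_nat ltnS (leq_trans hn).
Unshelve. all: end_near. Qed.
End FTC.

End HalfLine.

(** * The Gamma function *)

Section Gamma.
Context {R : realType}.
Notation mu := (@lebesgue_measure R).
Notation halfline := (`]0%R, +oo[%classic : set R).

Lemma is_derive_mull (a x : R) : is_derive x (1 : R) (fun t : R => a * t) a.
Proof. by apply: is_derive_eq; rewrite ?scaler0 ?addr0 /GRing.scale/= mulr1. Qed.

(** The change of variable by a dilation, on the open half-line since the
    functions to which it is applied need not be continuous at 0. *)
Lemma ge0_integral_scale (h : R -> R) (a : R) : 0 < a ->
  (forall x : R, 0 < x -> {for x, continuous h}) ->
  (forall x : R, 0 < x -> 0 <= h x) ->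
  (\int[mu]_(x in halfline) (h x)%:E = \int[mu]_(x in halfline) (h (a * x) * a)%:E)%E.
Proof.
move=> a0 ch h0.
have cg : forall x : R, 0 < x -> {for x, continuous (fun x => h (a * x) * a)}.
  move=> x x0; apply: cvgM; last exact: cvg_cst.
  apply: (@continuous_comp _ _ _ (fun x => a * x) h).
    by apply: cvgM; [exact: cvg_cst|exact: cvg_id].
  by apply: ch; rewrite mulr_gt0.
pose E n := `[a * n.+2%:R^-1, a * n.+2%:R]%classic : set R.
have EP n x : E n x <-> exhaust n (a^-1 * x).
  rewrite /E /exhaust /= !in_itv/= ler_pdivlMl// ler_pdivrMl//.
have E0 n x : E n x -> 0 < x.
  by move=> /EP /exhaust_gt0; rewrite pmulr_rgt0 ?invr_gt0.
have Enon : nondecreasing_seq E.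
  move=> m n mn; rewrite subsetEset => x /EP ?; apply/EP.
  by have := @exhaust_nondecreasing R _ _ mn; rewrite subsetEset; apply.
have EU : \bigcup_n E n = halfline.
  apply/seteqP; split => x; first by move=> [n _ /E0 ?]; apply/halflineP.
  move=> /halflineP x0.
  have : (\bigcup_n exhaust n) (a^-1 * x).
    by rewrite bigcup_exhaust; apply/halflineP; rewrite mulr_gt0// invr_gt0.
  by move=> [n _ ?]; exists n => //; apply/EP.
have cvg1 : (\int[mu]_(x in E n) (h x)%:E @[n --> \oo] -->
            \int[mu]_(x in \bigcup_n E n) (h x)%:E)%E.
  apply: ge0_nondecreasing_set_cvg_integral => //.
  - by move=> n; exact: measurable_itv.
  - move=> n; apply: (measurable_funS _ _ (measurableT_comp _ (measurable_fun_halfline ch))) => //.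
    by move=> x /E0 /halflineP.
  - by move=> n x /E0 x0; rewrite lee_fin h0.
have cvg2 : (\int[mu]_(x in exhaust n) (h (a * x) * a)%:E @[n --> \oo] -->
            \int[mu]_(x in \bigcup_n exhaust n) (h (a * x) * a)%:E)%E.
  apply: ge0_nondecreasing_set_cvg_integral => //.
  - exact: exhaust_nondecreasing.
  - by move=> n; exact: measurable_itv.
  - move=> n; apply: (measurable_funS _ _ (measurableT_comp _ (measurable_fun_halfline cg))) => //.
    by move=> x /exhaust_gt0 /halflineP.
  - by move=> n x /exhaust_gt0 x0; rewrite lee_fin mulr_ge0 ?h0 ?mulr_gt0// ltW.
rewrite EU in cvg1; rewrite bigcup_exhaust in cvg2.
suff EE : (fun n => \int[mu]_(x in E n) (h x)%:E)%E =
          (fun n => \int[mu]_(x in exhaust n) (h (a * x) * a)%:E)%E.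
  by rewrite EE in cvg1; exact: cvg_unique cvg1 cvg2.
apply/funext => n.
have da : ((fun x : R => a * x)^`())%classic = cst a.
  by apply/funext => x; rewrite derive1E; apply: derive_val; exact: is_derive_mull.
rewrite /E.
rewrite (@integration_by_substitution_increasing _ (fun x : R => a * x))//.
- by apply: eq_integral => x _ /=; rewrite !fctE da.
- by rewrite ltW// exhaust_bounds_lt.
- by move=> x y _ _ xy; rewrite ltr_pM2l.
- by rewrite da => x _; exact: cvg_cst.
- by rewrite da; apply/cvg_ex; exists a; exact: cvg_cst.
- by rewrite da; apply/cvg_ex; exists a; exact: cvg_cst.
- split.
  + by move=> x _; exact: derivableM.
  + apply: cvg_at_right_filter.
    by apply: cvgM; [exact: cvg_cst|exact: cvg_id].
  + apply: cvg_at_left_filter.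
    by apply: cvgM; [exact: cvg_cst|exact: cvg_id].
- by apply/continuous_in_subspaceT => x; rewrite inE => /(@E0 n); exact: ch.
Qed.

(** The part of the integral over [1, 2] is already at least [c]. *)
Lemma Rintegral_halfline_gt0 (f : R -> R) (c : R) : 0 < c ->
  mu.-integrable halfline (EFin \o f) ->
  (forall x : R, 0 < x -> 0 <= f x) ->
  (forall x : R, 1 <= x <= 2 -> c <= f x) ->
  0 < \int[mu]_(x in halfline) f x.
Proof.
move=> c0 intf f0 fc.
have sub : `[1%R, 2%R]%classic `<=` halfline.
  by move=> x; rewrite /= in_itv/= => /andP[h _]; apply/halflineP; lra.
have mf := measurable_int _ intf.
have h : (c%:E <= \int[mu]_(x in halfline) (f x)%:E)%E.
  apply: (@le_trans _ _ (\int[mu]_(x in `[1%R, 2%R]) (f x)%:E)%E); last first.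
    apply: ge0_subset_integral => //.
    by move=> x /halflineP x0; rewrite lee_fin f0.
  apply: (@le_trans _ _ (\int[mu]_(x in `[1%R, 2%R]) (cst c%:E x))%E); last first.
    apply: ge0_le_integral => //.
    - by move=> x _; rewrite lee_fin ltW.
    - by apply: measurable_funS mf.
  rewrite integral_cst; last exact: measurable_itv.
  rewrite /= lebesgue_measure_itv /= lte_fin.
  rewrite (_ : (1 : R) < 2 = true); last by lra.
  by rewrite -EFinB -EFinM lee_fin; lra.
have fin : (\int[mu]_(x in halfline) (f x)%:E)%E \is a fin_num.
  exact: integrable_fin_num.
by rewrite /Rintegral; rewrite -(fineK fin) lee_fin in h; apply: lt_le_trans h.
Qed.

(** With [v = a u / q] the left-hand side is [(q/a)^q] times [(v exp(-v))^q], and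
    [v <= exp v]. *)
Lemma powR_expR_le (q a u : R) : 0 < q -> 0 < a -> 0 < u ->
  u `^ q * expR (- (a * u)) <= (q / a) `^ q.
Proof.
move=> q0 a0 u0.
pose v := a * u / q.
have uE : u = (q / a) * v by rewrite /v; field; lra.
have v0 : 0 < v by rewrite /v divr_gt0 ?mulr_gt0.
clearbody v; rewrite {}uE.
rewrite powRM ?(ltW v0) ?divr_ge0 ?(ltW q0) ?(ltW a0)// -mulrA ler_piMr ?powR_ge0//.
have -> : - (a * (q / a * v)) = - (v * q) by field; lra.
rewrite expRN -ler_pdivlMr ?invr_gt0 ?expR_gt0// invrK mul1r expRM.
rewrite ge0_ler_powR ?nnegrE ?expR_ge0 ?(ltW v0) ?(ltW q0)//.
by rewrite (le_trans _ (expR_ge1Dx _))// lerDr.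
Qed.

Lemma is_derive_expRN (a x : R) :
  is_derive x (1 : R) (fun t : R => expR (- (a * t))) (- (a * expR (- (a * x)))).
Proof.
have h : is_derive x (1 : R) (fun t : R => - (a * t)) (- a).
  exact: is_deriveN (is_derive_mull _ _).
apply: (@is_derive_eq _ _ _ _ _ _ _ _ (is_derive1_comp (is_derive_expR _) h)).
by rewrite mulrN mulrC.
Qed.

Lemma is_derive_continuous (f : R -> R) x d : is_derive x (1 : R) f d -> {for x, continuous f}.
Proof.
by move=> h; apply: differentiable_continuous; apply/derivable1_diffP; have [] := h.
Qed.

Lemma continuous_powR (q x : R) : 0 < x -> {for x, continuous (fun t : R => t `^ q)}.
Proof. by move=> x0; exact: is_derive_continuous (is_derive1_powR _ x0). Qed.

Lemma continuous_expRN (a x : R) : {for x, continuous (fun t : R => expR (- (a * t)))}.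
Proof. exact: is_derive_continuous (is_derive_expRN _ _). Qed.

Lemma continuous_gamma (q a x : R) : 0 < x ->
  {for x, continuous (fun t : R => t `^ q * expR (- (a * t)))}.
Proof. by move=> x0; apply: cvgM; [exact: continuous_powR|exact: continuous_expRN]. Qed.

Lemma cvg_pinfty_le_inv (f : R -> R) (C : R) :
  (forall t : R, 0 < t -> 0 <= f t <= C / t) -> f x @[x --> +oo] --> (0 : R).
Proof.
move=> fC; apply: (@squeeze_cvgr _ _ _ _ (cst 0) (fun t : R => C * t^-1)).
- near=> t; apply: fC; near: t; apply: nbhs_pinfty_gt; exact: num_real.
- exact: cvg_cst.
- rewrite -[X in _ --> X](mulr0 C); apply: cvgM; first exact: cvg_cst.
  apply/cvgrPdist_lt => e e0; near=> t.
  have t0 : 0 < t by near: t; apply: nbhs_pinfty_gt; exact: num_real.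
  rewrite sub0r normrN gtr0_norm ?invr_gt0// invf_plt ?posrE//.
  near: t; apply: nbhs_pinfty_gt; exact: num_real.
Unshelve. all: end_near. Qed.

Lemma integrable_expRN : mu.-integrable halfline (EFin \o (fun t : R => expR (- t))).
Proof.
have -> : (fun t : R => expR (- t)) = (fun t : R => expR (- (1 * t))).
  by apply/funext => t; rewrite mul1r.
apply: (@integrable_of_bounded_primitive _ _ (fun t : R => - expR (- (1 * t))) _ _ 1).
- by move=> x _; exact: continuous_expRN.
- move=> x _.
  by apply: is_derive_eq (is_deriveN (is_derive_expRN _ _)) _; rewrite opprK mul1r.
- by move=> x _; exact: expR_ge0.
- move=> x x0; rewrite normrN ger0_norm ?expR_ge0// -[leRHS]expR0 ler_expR mul1r oppr_le0.
  exact: ltW.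
Qed.

(** One comparison handles both ends: [t^(s-1) / (1 + t^s)^2] has the bounded
    primitive [- 1 / (s (1 + t^s))], and [(1 + t^s)^2 exp(-t)] is bounded. *)
Lemma integrable_gamma (s : R) : 0 < s ->
  mu.-integrable halfline (EFin \o (fun t : R => t `^ (s - 1) * expR (- t))).
Proof.
move=> s0.
have p0 (t : R) : 0 < 1 + t `^ s by rewrite ltr_wpDr// powR_ge0.
have d (x : R) : 0 < x ->
    is_derive x (1 : R) (fun t : R => 1 + t `^ s) (s * x `^ (s - 1)).
  move=> x0; have := is_deriveD (is_derive_cst (1 : R) x 1) (is_derive1_powR s x0).
  by rewrite add0r.
have i1 : mu.-integrable halfline
    (EFin \o (fun t : R => t `^ (s - 1) * (1 + t `^ s) `^ (-1 - 1))).
  apply: (@integrable_of_bounded_primitive _ _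
    (fun t : R => - s^-1 * (1 + t `^ s) `^ (-1)) _ _ s^-1).
  - move=> x x0; apply: cvgM; first exact: continuous_powR.
    apply: (@continuous_comp _ _ _ (fun t : R => 1 + t `^ s) (fun y : R => y `^ (-1 - 1))).
      exact: is_derive_continuous (d _ x0).
    exact: continuous_powR.
  - move=> x x0.
    have h := is_deriveZ (- s^-1) (@is_derive1_comp _ (fun y : R => y `^ (-1))
      (fun t : R => 1 + t `^ s) _ _ _ (is_derive1_powR (-1) (p0 x)) (d _ x0)).
    apply: is_derive_eq h _; rewrite /GRing.scale /=.
    by field; rewrite gt_eqF.
  - by move=> x x0; rewrite mulr_ge0 ?powR_ge0.
  - move=> x x0; rewrite mulNr normrN ger0_norm; last first.
      by rewrite mulr_ge0 ?powR_ge0// invr_ge0 (ltW s0).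
    rewrite ler_piMr ?invr_ge0 ?(ltW s0)// powR_inv1 ?(ltW (p0 _))//.
    by rewrite invf_le1 ?p0// lerDl powR_ge0.
(* From (1 + y)^2 <= 2 (1 + y^2) at y = t^s and the bound on t^(2s) exp(-t). *)
pose C := 2 * (1 + (2 * s / 1) `^ (2 * s)).
apply: (le_integrable _ _ _ (integrableZl _ C i1)) => //.
- apply/measurable_EFinP; apply: measurable_fun_halfline => x x0.
  rewrite (_ : (fun t : R => t `^ (s - 1) * expR (- t)) =
    (fun t : R => t `^ (s - 1) * expR (- (1 * t)))); last first.
    by apply/funext => t; rewrite mul1r.
  exact: continuous_gamma.
- move=> t /halflineP t0; rewrite /= lee_fin.
  have C0 : 0 <= C by rewrite mulr_ge0// addr_ge0// powR_ge0.
  rewrite !ger0_norm ?mulr_ge0 ?powR_ge0 ?expR_ge0//.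
  have -> : (-1 - 1 : R) = - 2%:R by ring.
  rewrite powR_invn ?(ltW (p0 _))//.
  rewrite mulrCA ler_wpM2l ?powR_ge0// ler_pdivlMr ?exprn_gt0//.
  have h1 := @powR_expR_le (2 * s) 1 t _ ltr01 t0.
  have h2 : expR (- t) <= 1 by rewrite -expR0 ler_expR oppr_le0 ltW.
  have h3 : t `^ (2 * s) = (t `^ s) ^+ 2.
    by rewrite -powR_mulrn ?powR_ge0// -powRrM mulrC.
  have {}h1 := h1 (mulr_gt0 (ltr0n _ 2) s0).
  rewrite mul1r h3 in h1.
  have alg (e y D : R) : 0 <= e -> e <= 1 -> y ^+ 2 * e <= D ->
      e * (1 + y) ^+ 2 <= 2 * (1 + D).
    move=> e0 e1 yD.
    have : 0 <= e * (1 - y) ^+ 2 by rewrite mulr_ge0 ?sqr_ge0.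
    nra.
  exact: alg (expR_ge0 _) h2 h1.
  by rewrite addr_ge0// powR_ge0.
Qed.

(** Euler's Gamma function, meant for [s > 0]. *)
Definition Gam (s : R) := \int[mu]_(t in halfline) (t `^ (s - 1) * expR (- t)).

Lemma Gam_gt0 (s : R) : 0 < s -> 0 < Gam s.
Proof.
move=> s0; apply: (@Rintegral_halfline_gt0 _ (expR (- 2) / 2)).
- by rewrite divr_gt0 ?expR_gt0.
- exact: integrable_gamma.
- by move=> x x0; rewrite mulr_ge0 ?powR_ge0 ?expR_ge0.
- move=> x /andP[x1 x2].
  have x0 : 0 < x by lra.
  rewrite powRB ?(gt_eqF x0) ?implybT// powRr1 ?(ltW x0)//.
  rewrite [leRHS]mulrAC.
  have h1 : 1 <= x `^ s by rewrite -[leLHS](powRr0 x) ler_powR// ltW.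
  have h2 : expR (- 2) <= expR (- x) by rewrite ler_expR; lra.
  rewrite ler_pM ?expR_ge0 ?invr_ge0//.
    by rewrite -[leLHS]mul1r ler_pM ?expR_ge0.
  by rewrite lef_pV2 ?posrE.
Qed.

(** Integrate the derivative of [t^s exp(-t)]. *)
Lemma Gam_succ (s : R) : 0 < s -> Gam (s + 1) = s * Gam s.
Proof.
move=> s0; have s10 : 0 < s + 1 by lra.
have i1 := integrable_gamma s0.
have i2 := integrable_gamma s10; rewrite addrK in i2.
have i1' := integrable_halflineZ s i1.
apply/esym/eqP; rewrite -subr_eq0 /Gam addrK -RintegralZl//.
rewrite -RintegralB//; apply/eqP.
apply: (@integral_deriv_eq0 _ _ (fun t : R => t `^ s * expR (- (1 * t)))).
- move=> x x0.
  have h : {for x, continuous (fun t : R =>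
      s * (t `^ (s - 1) * expR (- (1 * t))) - t `^ s * expR (- (1 * t)))}.
    apply: cvgB; last exact: continuous_gamma.
    by apply: cvgM; [exact: cvg_cst|exact: continuous_gamma].
  by move: h; under [X in {for x, continuous X}]eq_fun do rewrite mul1r.
- move=> x x0.
  apply: is_derive_eq (is_deriveM (is_derive1_powR s x0) (is_derive_expRN 1 x)) _.
  rewrite /GRing.scale/= !mul1r; ring.
- exact: integrable_halflineB.
- apply: (@squeeze_cvgr _ _ _ _ (cst 0) (fun t : R => t `^ s)).
  + near=> t; have t0 : 0 < t by near: t; exact: nbhs_right_gt.
    rewrite /= mulr_ge0 ?powR_ge0 ?expR_ge0//= ler_piMr ?powR_ge0//.
    by rewrite -[leRHS]expR0 ler_expR mul1r oppr_le0 ltW.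
  + exact: cvg_cst.
  + exact: powR_cvg0.
- apply: (@cvg_pinfty_le_inv _ (((s + 1) / 1) `^ (s + 1))) => t t0.
  rewrite mulr_ge0 ?powR_ge0 ?expR_ge0//= ler_pdivlMr//.
  apply: le_trans (powR_expR_le s10 ltr01 t0).
  by rewrite powRD ?(gt_eqF t0) ?implybT// powRr1 ?(ltW t0)// mulrAC.
Unshelve. all: end_near. Qed.

Lemma integral_gamma_scale (p t : R) : 0 < p -> 0 < t ->
  (\int[mu]_(x in halfline) (x `^ (p - 1) * expR (- (t^-1 * x)))%:E =
   (Gam p * t `^ p)%:E)%E.
Proof.
move=> p0 t0.
have i1 := integrable_gamma p0.
rewrite (@ge0_integral_scale _ t)//; last 2 first.
- by move=> x x0; exact: continuous_gamma.
- by move=> x x0; rewrite mulr_ge0 ?powR_ge0 ?expR_ge0.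
rewrite EFinM /Gam fineK; last exact: integrable_fin_num.
rewrite muleC -integralZl//.
apply: eq_integral => x; rewrite inE => /halflineP x0.
rewrite -EFinM; congr EFin.
rewrite powRM ?(ltW t0) ?(ltW x0)// mulKf ?gt_eqF//.
rewrite -(mulr_powRB1 (ltW t0) p0); ring.
Qed.

End Gamma.

(** * Macdonald functions: integral representation and derivatives *)

Section Macdonald.
Context {R : realType}.
Notation mu := (@lebesgue_measure R).
Notation halfline := (`]0%R, +oo[%classic : set R).

(** The integrand of the Macdonald function after the scaling that defines [rho]:
    the prefactor [x^nu] is split off so that [x] only occurs in the exponential. *)
Definition macdonald_kernel (nu x t : R) : R := expR (- t - x / t) * t `^ (- nu - 1).

Definition macdonald_int (nu x : R) : R := \int[mu]_(t in halfline) macdonald_kernel nu x t.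

Lemma kernel_ge0 (nu x t : R) : 0 <= macdonald_kernel nu x t.
Proof. by rewrite mulr_ge0 ?expR_ge0 ?powR_ge0. Qed.

Lemma kernelS (nu x t : R) : 0 < t ->
  macdonald_kernel (nu + 1) x t = t^-1 * macdonald_kernel nu x t.
Proof.
move=> t0; rewrite /macdonald_kernel opprD [X in t `^ X]addrAC.
by rewrite powRB ?(gt_eqF t0) ?implybT// powRr1 ?(ltW t0)//; ring.
Qed.

(** A bound uniform in [x >= x0], obtained from [powR_expR_le] at [u = 1/t]. It
    dominates the kernel and, at order [nu + 1], its [x]-derivative; it also
    gives the decay at both ends of the half-line. *)
Lemma kernel_le (nu x0 x t : R) : -1 < nu -> 0 < x0 -> x0 <= x -> 0 < t ->
  macdonald_kernel nu x t <= ((nu + 1) / x0) `^ (nu + 1) * expR (- t).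
Proof.
move=> nu1 x00 x0x t0.
have q0 : 0 < nu + 1 by lra.
have it0 : 0 < t^-1 by rewrite invr_gt0.
rewrite /macdonald_kernel expRD mulrC mulrA mulrAC ler_wpM2r ?expR_ge0//.
apply: le_trans (powR_expR_le q0 x00 it0).
rewrite -powR_inv1 ?(ltW t0)// -powRrM mulN1r opprD ler_wpM2l ?powR_ge0//.
by rewrite ler_expR lerN2 ler_wpM2r ?powR_ge0.
Qed.

Lemma is_derive_div (x t : R) : 0 < t ->
  is_derive t (1 : R) (fun t : R => x / t) (- (x / t ^+ 2)).
Proof.
move=> t0.
have h : is_derive t (1 : R) (fun t : R => t^-1) (- (t ^- 2)).
  apply: DeriveDef.
    by apply: (@derivableV _ _ id) => //; rewrite gt_eqF.
  rewrite (@deriveV _ _ id) ?gt_eqF//= derive_id scaleNr.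
  by rewrite /GRing.scale/= mulr1.
apply: is_derive_eq (is_deriveZ x h) _.
by rewrite /GRing.scale/= mulrN.
Qed.

Lemma is_derive_kernel_t (nu x t : R) : 0 < t ->
  is_derive t (1 : R) (macdonald_kernel nu x)
    (- macdonald_kernel nu x t + x * macdonald_kernel (nu + 1 + 1) x t
     - (nu + 1) * macdonald_kernel (nu + 1) x t).
Proof.
move=> t0.
have h1 : is_derive t (1 : R) (fun t : R => - t - x / t) (- 1 - - (x / t ^+ 2)).
  exact: is_deriveB (is_deriveNid _ _) (is_derive_div x t0).
have h2 := @is_derive1_comp _ expR (fun t : R => - t - x / t) _ _ _ (is_derive_expR _) h1.
apply: is_derive_eq (is_deriveM h2 (is_derive1_powR (- nu - 1) t0)) _.
rewrite !kernelS// /macdonald_kernel /GRing.scale/=.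
rewrite powRB ?(gt_eqF t0) ?implybT// powRr1 ?(ltW t0)//.
by field; rewrite gt_eqF.
Qed.

Lemma continuous_kernel_t (nu x t : R) : 0 < t -> {for t, continuous (macdonald_kernel nu x)}.
Proof. by move=> t0; exact: is_derive_continuous (is_derive_kernel_t _ _ t0). Qed.

Lemma integrable_kernel (nu x : R) : -1 < nu -> 0 < x ->
  mu.-integrable halfline (EFin \o macdonald_kernel nu x).
Proof.
move=> nu1 x0.
have := integrable_halflineZ (((nu + 1) / x) `^ (nu + 1)) (@integrable_expRN R).
apply: le_integrable => //.
  apply/measurable_EFinP; apply: measurable_fun_halfline => t.
  exact: continuous_kernel_t.
move=> t /halflineP t0; rewrite /= lee_fin.
rewrite !ger0_norm ?kernel_ge0 ?mulr_ge0 ?powR_ge0 ?expR_ge0//.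
exact: kernel_le.
Qed.

(** The three-term recurrence of the Macdonald functions: the [t]-derivative of
    the kernel, a combination of kernels of three consecutive orders, integrates
    to 0. *)
Lemma macdonald_int_rec (nu x : R) : -1 < nu -> 0 < x ->
  x * macdonald_int (nu + 1 + 1) x = (nu + 1) * macdonald_int (nu + 1) x + macdonald_int nu x.
Proof.
move=> nu1 x0.
have i0 := integrable_kernel nu1 x0.
have nu2 : -1 < nu + 1 by lra.
have i1 := integrable_halflineZ (nu + 1) (integrable_kernel nu2 x0).
have nu3 : -1 < nu + 1 + 1 by lra.
have i2 := integrable_halflineZ x (integrable_kernel nu3 x0).
have i3 := integrable_halflineB (integrable_halflineB i2 i0) i1.
suff : \int[mu]_(t in halfline) (x * macdonald_kernel (nu + 1 + 1) x t - macdonald_kernel nu x t -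
    (nu + 1) * macdonald_kernel (nu + 1) x t) = 0.
  rewrite RintegralB//; last exact: integrable_halflineB.
  rewrite RintegralB// !RintegralZl//; try exact: integrable_kernel.
  rewrite -/(macdonald_int _ _) -/(macdonald_int _ _) -/(macdonald_int _ _); lra.
apply: (@integral_deriv_eq0 _ _ (macdonald_kernel nu x)) => //.
- move=> t t0; apply: cvgB; first apply: cvgB; first apply: cvgM.
  + exact: cvg_cst.
  + exact: continuous_kernel_t.
  + exact: continuous_kernel_t.
  + by apply: cvgM; [exact: cvg_cst|exact: continuous_kernel_t].
- move=> t t0; apply: is_derive_eq (is_derive_kernel_t nu x t0) _; ring.
- pose C := ((nu + 1 + 1) / x) `^ (nu + 1 + 1).
  apply: (@squeeze_cvgr _ _ _ _ (cst 0) (fun t : R => C * t)).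
  (* The bound at order nu + 1, where the kernel has an extra factor 1/t. *)
  + near=> t; have t0 : 0 < t by near: t; exact: nbhs_right_gt.
    rewrite kernel_ge0/=.
    have := kernel_le nu2 x0 (lexx x) t0.
    rewrite kernelS// ler_pdivrMl// => /le_trans; apply.
    rewrite -/C mulrCA ler_wpM2l ?powR_ge0// ler_piMr ?(ltW t0)//.
    by rewrite -[leRHS]expR0 ler_expR oppr_le0 ltW.
  + exact: cvg_cst.
  + rewrite -[X in _ --> X](mulr0 C); apply: cvgM; first exact: cvg_cst.
    by apply: cvg_at_right_filter; exact: cvg_id.
- apply: (@cvg_pinfty_le_inv _ _ (((nu + 1) / x) `^ (nu + 1))) => t t0.
  rewrite kernel_ge0/=.
  apply: le_trans (kernel_le nu1 x0 (lexx x) t0) _.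
  rewrite ler_wpM2l ?powR_ge0// expRN lef_pV2 ?posrE ?expR_gt0//.
  by rewrite (le_trans _ (expR_ge1Dx _))// lerDr.
Unshelve. all: end_near. Qed.

Lemma is_derive_kernel_x (nu x t : R) : 0 < t ->
  is_derive x (1 : R) (fun x => macdonald_kernel nu x t) (- macdonald_kernel (nu + 1) x t).
Proof.
move=> t0.
have h1 : is_derive x (1 : R) (fun x : R => - t - x / t) (0 - t^-1).
  apply: is_deriveB; rewrite (_ : (fun x => x / t) = (fun x => t^-1 * x)).
    exact: is_derive_mull.
  by apply/funext => y; rewrite mulrC.
have h2 := @is_derive1_comp _ expR (fun x : R => - t - x / t) _ _ _ (is_derive_expR _) h1.
have h3 := is_deriveZ (t `^ (- nu - 1)) h2.
rewrite (_ : (fun x => macdonald_kernel nu x t) =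
   (fun x => t `^ (- nu - 1) * expR (- t - x / t))); last first.
  by apply/funext => y; rewrite /macdonald_kernel mulrC.
apply: is_derive_eq h3 _; rewrite kernelS// /macdonald_kernel /GRing.scale/=; ring.
Qed.

(** Differentiation under the integral sign: locally in [x], the derivative of the
    kernel is dominated by a multiple of [exp(-t)]. *)
Lemma is_derive_macdonald_int (nu x : R) : -1 < nu -> 0 < x ->
  is_derive x (1 : R) (macdonald_int nu) (- macdonald_int (nu + 1) x).
Proof.
move=> nu1 x0.
have nu2 : -1 < nu + 1 by lra.
(* The x-derivative of the kernel is minus the kernel of order nu + 1. *)
pose C := ((nu + 1 + 1) / (x / 2)) `^ (nu + 1 + 1).
have xI : `]x / 2, (2 * x)[%classic x by rewrite /= in_itv/=; apply/andP; split; lra.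
have pos y : `]x / 2, (2 * x)[%classic y -> 0 < y.
  by rewrite /= in_itv/= => /andP[h _]; lra.
have d1E y t : 0 < t -> partial1of2 (macdonald_kernel nu) y t = - macdonald_kernel (nu + 1) y t.
  move=> t0; rewrite /partial1of2 derive1E; apply: derive_val.
  exact: is_derive_kernel_x.
have intf y : `]x / 2, (2 * x)[%classic y ->
   mu.-integrable halfline (EFin \o macdonald_kernel nu y).
  by move=> /pos; exact: integrable_kernel.
have derf y t : `]x / 2, (2 * x)[%classic y -> halfline t ->
    derivable (macdonald_kernel nu ^~ t) y 1.
  by move=> _ /halflineP t0; have [] := is_derive_kernel_x nu y t0.
have G0 (t : R) : 0 <= C * expR (- t) by rewrite mulr_ge0 ?powR_ge0 ?expR_ge0.
have intG : mu.-integrable halfline (EFin \o (fun t : R => C * expR (- t))).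
  exact/integrable_halflineZ/integrable_expRN.
have Gub y t : `]x / 2, (2 * x)[%classic y -> halfline t ->
    `|partial1of2 (macdonald_kernel nu) y t| <= C * expR (- t).
  move=> yI /halflineP t0; rewrite d1E// normrN ger0_norm ?kernel_ge0//.
  apply: kernel_le => //; first by rewrite divr_gt0.
  by move: yI; rewrite /= in_itv/= => /andP[/ltW].
apply: DeriveDef.
  exact: (derivable_under_integral _ xI intf derf G0 intG Gub).
rewrite -derive1E (differentiation_under_integral _ xI intf derf G0 intG Gub)//.
rewrite (eq_Rintegral_halfline (g := fun t => -1 * macdonald_kernel (nu + 1) x t)).
  by rewrite RintegralZl ?mulN1r//; exact: integrable_kernel.
by move=> t t0; rewrite d1E// mulN1r.
Qed.

(** At [z = 2 sqrt x] the exponent [z^2 / (4 t)] becomes [x / t], and the two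
    prefactors [x^(nu/2)] and [(z/2)^nu] multiply to [x^nu]. *)
Lemma rhoE (nu x : R) : 0 < x -> rho nu x = x `^ nu * macdonald_int nu x.
Proof.
move=> x0; rewrite /rho /macdonaldK.
have -> : 2 * Num.sqrt x / 2 = Num.sqrt x by field.
have -> : (2 * Num.sqrt x) ^+ 2 = 4 * x.
  by rewrite exprMn sqr_sqrtr ?(ltW x0)// -natrX.
rewrite -powR12_sqrt ?(ltW x0)// -powRrM.
have -> : x `^ nu = x `^ (nu / 2) * x `^ (2^-1 * nu).
  by rewrite -powRD ?(gt_eqF x0) ?implybT//; congr powR; field.
rewrite /macdonald_int (eq_Rintegral_halfline (g := macdonald_kernel nu x)).
  by field.
move=> t t0; rewrite /macdonald_kernel; congr (expR (_ - _) * _).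
by field; rewrite gt_eqF.
Qed.

Lemma near_gt0 (x : R) : 0 < x -> \forall y \near x, 0 < y.
Proof. exact: lt_nbhsr. Qed.

(** Differentiate [x^nu] times the integral of the kernel. *)
Lemma is_derive_rho (nu x : R) : -1 < nu -> 0 < x ->
  is_derive x (1 : R) (rho nu) ((nu * rho nu x - rho (nu + 1) x) / x).
Proof.
move=> nu1 x0.
have h := is_deriveM (is_derive1_powR nu x0) (is_derive_macdonald_int nu1 x0).
apply: (@near_eq_is_derive _ _ _ (fun x => x `^ nu * macdonald_int nu x)).
  by near=> y; rewrite rhoE//; near: y; exact: near_gt0.
apply: is_derive_eq h _; rewrite !rhoE// /GRing.scale/=.
rewrite powRB ?powRD ?(gt_eqF x0) ?implybT// powRr1 ?(ltW x0)//.
by field; rewrite gt_eqF.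
Unshelve. all: end_near. Qed.

(** The previous formula at order [nu + 1] involves [rho] of order [nu + 2], which
    the three-term recurrence removes. *)
Lemma is_derive_rhoS (nu x : R) : -1 < nu -> 0 < x ->
  is_derive x (1 : R) (rho (nu + 1)) (- rho nu x).
Proof.
move=> nu1 x0; have nu2 : -1 < nu + 1 by lra.
apply: is_derive_eq (is_derive_rho nu2 x0) _.
rewrite !rhoE// !powRD ?(gt_eqF x0) ?implybT// powRr1 ?(ltW x0)//.
have := macdonald_int_rec nu1 x0 => e.
have -> : macdonald_int nu x =
    x * macdonald_int (nu + 1 + 1) x - (nu + 1) * macdonald_int (nu + 1) x.
  by rewrite e; ring.
by field; rewrite gt_eqF.
Qed.

End Macdonald.

(** * Mellin transform of the scaled Macdonald function *)

Section Moments.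
Context {R : realType}.
Notation mu := (@lebesgue_measure R).
Notation halfline := (`]0%R, +oo[%classic : set R).

(** Tonelli's theorem on the quadrant, through extension by 0 to the plane. *)
Lemma halfline_tonelli (g : R -> R -> R) :
  measurable_fun setT (fun z : measurableTypeR R * measurableTypeR R => g z.1 z.2) ->
  (forall x t : R, 0 < x -> 0 < t -> 0 <= g x t) ->
  (\int[mu]_(x in halfline) \int[mu]_(t in halfline) (g x t)%:E =
   \int[mu]_(t in halfline) \int[mu]_(x in halfline) (g x t)%:E)%E.
Proof.
move=> mg g0.
pose f (z : measurableTypeR R * measurableTypeR R) : \bar R :=
  (\1_halfline z.1 * (\1_halfline z.2 * g z.1 z.2))%:E.
have f0 z : (0 <= f z)%E.
  rewrite lee_fin /f !indicE.
  case: (boolP (z.1 \in _)) => [|_]; last by rewrite mul0r.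
  case: (boolP (z.2 \in _)) => [|_]; last by rewrite mul0r mulr0.
  by rewrite !inE => /halflineP h2 /halflineP h1; rewrite !mul1r g0.
have mf : measurable_fun setT f.
  apply/measurable_EFinP; apply: measurable_funM.
    apply: (measurableT_comp _ measurable_fst).
    by apply: measurable_indic; exact: measurable_itv.
  apply: measurable_funM => //.
  apply: (measurableT_comp _ measurable_snd).
  by apply: measurable_indic; exact: measurable_itv.
have fub := @fubini_tonelli _ _ _ _ R mu mu f mf f0.
rewrite [LHS]integral_mkcond [RHS]integral_mkcond.
transitivity (\int[mu]_x \int[mu]_y f (x, y))%E; last first.
  rewrite fub; apply: eq_integral => t _.
  rewrite patchE; case: ifPn => ht.
    rewrite [RHS]integral_mkcond; apply: eq_integral => x _.
    by rewrite patchE /f /= !indicE ht; case: ifPn; rewrite ?mul0r ?mul1r.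
  rewrite integral0_eq// => x _.
  by rewrite /f /= !indicE (negbTE ht) mul0r mulr0.
apply: eq_integral => t _.
rewrite patchE; case: ifPn => ht.
  rewrite [LHS]integral_mkcond; apply: eq_integral => x _.
  by rewrite patchE /f /= !indicE ht; case: ifPn; rewrite ?mul0r ?mul1r.
rewrite integral0_eq// => x _.
by rewrite /f /= !indicE (negbTE ht) mul0r.
Qed.

Lemma continuous_rho (nu x : R) : -1 < nu -> 0 < x -> {for x, continuous (rho nu)}.
Proof. by move=> nu1 x0; exact: is_derive_continuous (is_derive_rho nu1 x0). Qed.

Lemma rho_ge0 (nu x : R) : 0 < x -> 0 <= rho nu x.
Proof.
move=> x0; rewrite rhoE// mulr_ge0 ?powR_ge0// Rintegral_ge0// => t _.
exact: kernel_ge0.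
Qed.

(** Exchange the two integrals: the inner [x]-integral is a Gamma integral dilated
    by [t], equal to [Gam (s + nu) * t ^ (s + nu)], and what remains is
    [Gam s]. *)
Lemma ge0_integral_moment (nu s : R) : -1 < nu -> 0 < s -> 0 < s + nu ->
  (\int[mu]_(x in halfline) (x `^ (s - 1) * rho nu x)%:E =
   (Gam s * Gam (s + nu))%:E)%E.
Proof.
move=> nu1 s0 snu0.
(* 1/t is written as a power, a measurable function on the whole line. *)
pose g (x t : R) := x `^ (s + nu - 1) *
  (expR (- t - x * t `^ (-1)) * t `^ (- nu - 1)).
have gE (x t : R) : 0 < t -> g x t = x `^ (s + nu - 1) * macdonald_kernel nu x t.
  by move=> t0; rewrite /g powR_inv1 ?(ltW t0).
transitivity (\int[mu]_(x in halfline) \int[mu]_(t in halfline) (g x t)%:E)%E.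
  apply: eq_integral => x; rewrite inE => /halflineP x0.
  have ik := integrable_kernel nu1 x0.
  rewrite rhoE// mulrA -powRD ?(gt_eqF x0) ?implybT//.
  rewrite (_ : s - 1 + nu = s + nu - 1); last by ring.
  rewrite /macdonald_int -RintegralZl// /Rintegral fineK; last first.
    by apply: integrable_fin_num => //; exact: integrable_halflineZ.
  by apply: eq_integral => t; rewrite inE => /halflineP t0; rewrite gE.
rewrite halfline_tonelli; last 2 first.
- apply: measurable_funM.
    exact: (measurableT_comp (measurable_powR _) measurable_fst).
  apply: measurable_funM.
    apply: measurableT_comp => //; apply: measurable_funB.
      by apply: measurableT_comp => //; exact: measurable_snd.
    apply: measurable_funM; first exact: measurable_fst.
    exact: (measurableT_comp (measurable_powR _) measurable_snd).
  exact: (measurableT_comp (measurable_powR _) measurable_snd).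
- by move=> x t x0 t0; rewrite gE// mulr_ge0 ?powR_ge0 ?kernel_ge0.
transitivity (\int[mu]_(t in halfline) ((Gam (s + nu))%:E * (t `^ (s - 1) * expR (- t))%:E))%E.
  apply: eq_integral => t; rewrite inE => /halflineP t0.
  transitivity ((t `^ (- nu - 1) * expR (- t))%:E *
     \int[mu]_(x in halfline) (x `^ (s + nu - 1) * expR (- (t^-1 * x)))%:E)%E.
    rewrite -ge0_integralZl//.
    - apply: eq_integral => x _; rewrite -EFinM; congr EFin.
      by rewrite gE// /macdonald_kernel expRD [x / t]mulrC; ring.
    - apply/measurable_EFinP; apply: measurable_fun_halfline => x.
      exact: continuous_gamma.
    - by move=> x _; rewrite lee_fin mulr_ge0 ?powR_ge0 ?expR_ge0.
    - by rewrite lee_fin mulr_ge0 ?powR_ge0 ?expR_ge0.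
  rewrite integral_gamma_scale// -!EFinM; congr EFin.
  rewrite (_ : s - 1 = - nu - 1 + (s + nu)); last by ring.
  by rewrite [in RHS]powRD ?(gt_eqF t0) ?implybT//; ring.
rewrite integralZl//; last exact: integrable_gamma.
rewrite EFinM muleC; congr (_ * _)%E.
by rewrite /Gam fineK//; apply: integrable_fin_num => //; exact: integrable_gamma.
Qed.

Lemma integrable_moment (nu s : R) : -1 < nu -> 0 < s -> 0 < s + nu ->
  mu.-integrable halfline (EFin \o (fun x => x `^ (s - 1) * rho nu x)).
Proof.
move=> nu1 s0 snu0; apply/integrableP; split.
  apply/measurable_EFinP; apply: measurable_fun_halfline => x x0.
  by apply: cvgM; [exact: continuous_powR|exact: continuous_rho].
rewrite (_ : (\int[mu]_(x in halfline) _ = (Gam s * Gam (s + nu))%:E)%E) ?ltry//.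
rewrite -ge0_integral_moment//; apply: eq_integral => x; rewrite inE => /halflineP x0.
by rewrite /= ger0_norm// mulr_ge0 ?powR_ge0 ?rho_ge0.
Qed.

Lemma moment (nu s : R) : -1 < nu -> 0 < s -> 0 < s + nu ->
  \int[mu]_(x in halfline) (x `^ (s - 1) * rho nu x) = Gam s * Gam (s + nu).
Proof. by move=> nu1 s0 snu0; rewrite /Rintegral ge0_integral_moment. Qed.

End Moments.

(** * Mellin symbols and the Rodrigues recurrence *)

Section Algebra.
Context {R : realType}.
Implicit Types (W : nat -> {poly R}) (p q A B : {poly R}).

(** The linear map sending ['X^i] to [W i]. It is used through
    linearity and through its behaviour under multiplication by ['X] and under
    the Euler operator ['X * d/dX], the only operations in [rodrigues_step]. *)
Definition expansion W p := \sum_(i < size p) p`_i *: W i.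

Lemma expansion_widen W n p : (size p <= n)%N -> expansion W p = \sum_(i < n) p`_i *: W i.
Proof.
move=> pn; rewrite /expansion (big_ord_widen _ (fun i => p`_i *: W i) pn) big_mkcond/=.
apply: eq_bigr => i _; case: ltnP => // hi.
by rewrite nth_default// scale0r.
Qed.

Lemma expansionD W p q : expansion W (p + q) = expansion W p + expansion W q.
Proof.
pose n := maxn (size p) (size q).
rewrite (@expansion_widen _ n p) ?leq_maxl// (@expansion_widen _ n q) ?leq_maxr//.
rewrite (@expansion_widen _ n) ?size_polyD// -big_split/=.
by apply: eq_bigr => i _; rewrite coefD scalerDl.
Qed.

Lemma expansionZ W c p : expansion W (c *: p) = c *: expansion W p.
Proof.
rewrite (@expansion_widen _ (size p)) ?size_scale_leq// scaler_sumr.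
by apply: eq_bigr => i _; rewrite coefZ scalerA.
Qed.

Lemma expansionN W p : expansion W (- p) = - expansion W p.
Proof. by rewrite -scaleN1r expansionZ scaleN1r. Qed.

Lemma expansionB W p q : expansion W (p - q) = expansion W p - expansion W q.
Proof. by rewrite expansionD expansionN. Qed.

Lemma expansion_mulX W p : expansion W ('X * p) = expansion (fun i => W i.+1) p.
Proof.
rewrite (@expansion_widen _ (size p).+1); last first.
  by rewrite (leq_trans (size_polyMleq _ _))// size_polyX.
rewrite big_ord_recl coefXM/= scale0r add0r.
by apply: eq_bigr => i _; rewrite coefXM.
Qed.

Lemma expansion_euler W p : expansion W ('X * p^`()) = expansion (fun i => i%:R *: W i) p.
Proof.
rewrite (@expansion_widen _ (size p)); last first.
  have [->|p0] := eqVneq p 0; first by rewrite deriv0 mulr0.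
  rewrite (leq_trans (size_polyMleq _ _))// size_polyX/=.
  exact: lt_size_deriv.
apply: eq_bigr => -[i hi] _ /=; rewrite coefXM scalerA.
case: i hi => [|i] hi /=; first by rewrite mulr0.
by rewrite coef_deriv mulr_natr.
Qed.

Lemma size_expansion_le W p n (f : nat -> nat) :
  (forall i, (size (W i) <= f i)%N) -> {homo f : i j / (i <= j)%N} ->
  (size p <= n.+1)%N -> (size (expansion W p) <= f n)%N.
Proof.
move=> Wf fmon pn; rewrite (leq_trans (size_sum _ _ _))//.
apply/bigmax_leqP => i _; rewrite (leq_trans (size_scale_leq _ _))//.
by rewrite (leq_trans (Wf _))// fmon// -ltnS (leq_trans (ltn_ord i)).
Qed.

(** When the degrees of the [W i] strictly increase, leading terms cannot cancel. *)
Lemma size_expansion W p (f : nat -> nat) :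
  (forall i, size (W i) = f i) -> (0 < f 0)%N -> {homo f : i j / (i < j)%N} ->
  p != 0 -> size (expansion W p) = f (size p).-1.
Proof.
move=> Wf f0 fmon p0; rewrite /expansion.
have : (0 < size p)%N by rewrite size_poly_gt0.
case E : (size p) => [//|n] _ /=; rewrite big_ord_recr/= addrC.
have pn : p`_n != 0 by rewrite -[n]/(n.+1.-1) -E -lead_coefE lead_coef_eq0.
rewrite size_polyDl size_scale ?Wf//.
case: n E pn => [|n] E pn.
  by rewrite big_ord0 size_poly0.
rewrite (@leq_ltn_trans (f n)) ?fmon//.
rewrite (leq_trans (size_sum _ _ _))//.
apply/bigmax_leqP => i _; rewrite (leq_trans (size_scale_leq _ _))// Wf.
have := ltn_ord i; rewrite ltnS leq_eqVlt => /orP[/eqP->//|/fmon/ltnW//].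
Qed.

Section Mellin.
Variable nu : R.

(** The product [(s)_i (s + nu)_i] of rising factorials, as a polynomial in [s]:
    the quotient by [Gam s * Gam (s + nu)] of the moment of [x^i rho_nu]. The
    next definition does the same for [x^i rho_(nu+1)]. *)
Fixpoint mellinU (i : nat) : {poly R} :=
  if i is j.+1 then mellinU j * ('X + (nu + j%:R)%:P) * ('X + (j%:R)%:P) else 1.

Definition mellinV (i : nat) : {poly R} := mellinU i * ('X + (nu + i%:R)%:P).

Lemma mellinU_monic i : mellinU i \is monic.
Proof.
elim: i => [|i IH] /=; first exact: monic1.
have h (c : R) : 'X + c%:P \is monic by rewrite -[c]opprK polyCN monicXsubC.
by rewrite !monicMl.
Qed.

Lemma size_mellinU i : size (mellinU i) = (2 * i).+1.
Proof.
elim: i => [|i IH] /=; first by rewrite size_poly1.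
have m1 := mellinU_monic i.
have h (c : R) : size ('X + c%:P) = 2 by rewrite -[c]opprK polyCN size_XsubC.
have h' (c : R) : 'X + c%:P \is monic by rewrite -[c]opprK polyCN monicXsubC.
by rewrite !size_monicM ?monicMl ?monic_neq0 ?h'// !h IH !addn2 /= mulnS.
Qed.

Lemma size_mellinV i : size (mellinV i) = (2 * i).+2.
Proof.
rewrite /mellinV -[X in 'X + X%:P]opprK polyCN size_monicM ?mellinU_monic//.
  by rewrite size_mellinU size_XsubC addn2.
by rewrite monic_neq0// monicXsubC.
Qed.

(** Up to Gamma factors, the Mellin transform of the type 1 form given by the
    pair. *)
Definition mellin (q : {poly R} * {poly R}) :=
  expansion mellinU q.1 + expansion mellinV q.2.

Lemma mellinB_scale A B C D c :
  mellin (A - c *: C, B - c *: D) = mellin (A, B) - c *: mellin (C, D).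
Proof.
by rewrite /mellin !expansionB !expansionZ scalerDr opprD addrACA.
Qed.

Lemma size_mellin_le A B N :
  (size A <= N./2.+1)%N -> (size B <= N.+1./2)%N -> (size (mellin (A, B)) <= N.+1)%N.
Proof.
move=> sA sB; rewrite /mellin/= (leq_trans (size_polyD _ _))// geq_max.
have hU : (size (expansion mellinU A) <= N.+1)%N.
  rewrite (leq_trans (@size_expansion_le _ _ _ (fun i => (2 * i).+1) _ _ sA))//.
  - by move=> i; rewrite size_mellinU.
  - by move=> i j ij; rewrite ltnS leq_mul2l.
  - lia.
have hV : (size (expansion mellinV B) <= N.+1)%N.
  case: (posnP (size B)) => [/eqP|B0].
    by rewrite size_poly_eq0 => /eqP ->; rewrite /expansion size_poly0 big_ord0 size_poly0.
  have sB' : (size B <= (N.+1)./2.-1.+1)%N by lia.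
  rewrite (leq_trans (@size_expansion_le _ _ _ (fun i => (2 * i).+2) _ _ sB'))//.
  - by move=> i; rewrite size_mellinV.
  - by move=> i j ij; rewrite !ltnS leq_mul2l.
  - lia.
by rewrite hU hV.
Qed.

(** The degrees in [mellinU] are even and those in [mellinV] odd, so the leading
    terms of the two expansions never cancel. *)
Lemma mellin_eq0 A B : mellin (A, B) = 0 -> A = 0 /\ B = 0.
Proof.
rewrite /mellin/= => AB.
have hU : A != 0 -> size (expansion mellinU A) = (2 * (size A).-1).+1.
  apply: (@size_expansion _ _ (fun i => (2 * i).+1)) => //; first exact: size_mellinU.
  by move=> i j ij; rewrite ltnS ltn_pmul2l.
have hV : B != 0 -> size (expansion mellinV B) = (2 * (size B).-1).+2.
  apply: (@size_expansion _ _ (fun i => (2 * i).+2)) => //; first exact: size_mellinV.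
  by move=> i j ij; rewrite !ltnS ltn_pmul2l.
have e0 W : expansion W 0 = 0 by rewrite /expansion size_poly0 big_ord0.
have [A0|A0] := eqVneq A 0.
  split=> //; apply/eqP/negPn/negP => /hV.
  by move: AB; rewrite A0 e0 add0r => ->; rewrite size_poly0.
have [B0|B0] := eqVneq B 0.
  by move: (hU A0); move: AB; rewrite B0 e0 addr0 => ->; rewrite size_poly0.
move/eqP: AB; rewrite addr_eq0 => /eqP /(congr1 (fun p : {poly R} => size p)).
by rewrite size_polyN hU// hV//; lia.
Qed.

(** The action of [d/dx] on [x^a (A rho_nu + B rho_(nu+1))], once a factor
    [x^(a-1)] is taken out. *)
Definition rodrigues_step (a : R) (q : {poly R} * {poly R}) : {poly R} * {poly R} :=
  ((a + nu) *: q.1 + 'X * q.1^`() - 'X * q.2, a *: q.2 + 'X * q.2^`() - q.1).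

(** Coefficientwise this is [(a + nu + i) U_i - V_i = (a - 'X) U_i] and
    [(a + i) V_i - U_(i+1) = (a - 'X) V_i]: the transform of [x^(1-a) d/dx x^a] is
    multiplication by [a - s]. *)
Lemma mellin_step a (q : {poly R} * {poly R}) :
  mellin (rodrigues_step a q) = (a%:P - 'X) * mellin q.
Proof.
case: q => A B; rewrite /mellin /rodrigues_step/=.
rewrite !(expansionB, expansionD, expansionZ) !expansion_euler !expansion_mulX.
pose n := maxn (size A) (size B).
rewrite !(@expansion_widen _ n A) ?leq_maxl// !(@expansion_widen _ n B) ?leq_maxr//.
rewrite !scaler_sumr -!big_split/= -!sumrN -!big_split/= mulr_sumr.
apply: eq_bigr => i _.
rewrite /mellinV -!mul_polyC !polyCD.
ring.
Qed.

Fixpoint rodrigues (e : R) (j : nat) : {poly R} * {poly R} :=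
  if j is i.+1 then rodrigues_step (e - i%:R) (rodrigues e i) else (1, 0).

Lemma mellin_rodrigues e j :
  mellin (rodrigues e j) = \prod_(i < j) ((e - i%:R)%:P - 'X).
Proof.
elim: j => [|j IH] /=.
  rewrite big_ord0 /mellin /expansion/= size_poly0 size_poly1 big_ord0 big_ord1 addr0.
  by rewrite coef1 scale1r.
by rewrite mellin_step IH big_ord_recr/= mulrC.
Qed.

(** Each step raises the two degree bounds alternately: first that of [B], then
    that of [A]. *)
Lemma size_rodrigues e j :
  (size (rodrigues e j).1 <= j./2.+1)%N /\ (size (rodrigues e j).2 <= j.+1./2)%N.
Proof.
elim: j => [|j [IH1 IH2]]; first by rewrite /= size_poly1 size_poly0.
move: IH1 IH2; rewrite [rodrigues e j.+1]/= /rodrigues_step.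
case: (rodrigues e j) => A B /=; rewrite uphalfE => sA sB.
have sX p : (size ('X * p)%R <= (size p).+1)%N.
  by rewrite (leq_trans (size_polyMleq _ _))// size_polyX.
have sE p : (size ('X * p^`())%R <= size p)%N.
  have [->|p0] := eqVneq p 0; first by rewrite deriv0 mulr0.
  by rewrite (leq_trans (sX _))// lt_size_deriv.
have sZ a p : (size (a *: p) <= size p)%N by exact: size_scale_leq.
have hj : (j./2.+1 <= j.+1./2.+1)%N by lia.
split; rewrite (leq_trans (size_polyD _ _))// size_polyN geq_max.
  rewrite (leq_trans (sX _))// andbT (leq_trans (size_polyD _ _))// geq_max.
  by rewrite !(leq_trans _ hj)// (leq_trans _ sA)// sZ.
rewrite sA andbT (leq_trans (size_polyD _ _))// geq_max.
have hj2 : (j.+1./2 <= j./2.+1)%N by lia.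
by rewrite !(leq_trans _ hj2)// (leq_trans _ sB)// sZ.
Qed.

End Mellin.
End Algebra.

(** * Rodrigues formula and uniqueness *)

Section Rodrigues.
Context {R : realType}.
Notation mu := (@lebesgue_measure R).
Notation halfline := (`]0%R, +oo[%classic : set R).
Variable nu : R.
Hypothesis nu0 : 0 <= nu.

Let nu1 : -1 < nu. Proof. exact: lt_le_trans (ltrN10 R) nu0. Qed.

Lemma is_derive_type1 (a x : R) (q : {poly R} * {poly R}) : 0 < x ->
  is_derive x (1 : R) (fun x => x `^ a * type1_fun nu q.1 q.2 x)
   (x `^ (a - 1) * type1_fun nu (rodrigues_step nu a q).1 (rodrigues_step nu a q).2 x).
Proof.
move=> x0; case: q => A B /=.
have hA := is_deriveM (is_derive_poly A x) (is_derive_rho nu1 x0).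
have hB := is_deriveM (is_derive_poly B x) (is_derive_rhoS nu1 x0).
have h := is_deriveM (is_derive1_powR a x0) (is_deriveD hA hB).
apply: is_derive_eq h _; rewrite /type1_fun /rodrigues_step /GRing.scale/=.
rewrite !(hornerD, hornerN, hornerM, hornerZ, hornerX).
rewrite powRB ?(gt_eqF x0) ?implybT// powRr1 ?(ltW x0)//.
rewrite (_ : (horner A * rho nu + horner B * rho (nu + 1)) x =
  A.[x] * rho nu x + B.[x] * rho (nu + 1) x)//.
by field; rewrite gt_eqF.
Qed.

Lemma derive1n_rodrigues (e : R) (j : nat) (x : R) : 0 < x ->
  derive1n j (fun x => x `^ e * rho nu x) x =
  x `^ (e - j%:R) * type1_fun nu (rodrigues nu e j).1 (rodrigues nu e j).2 x.
Proof.
elim: j x => [|j IH] x x0.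
  by rewrite /type1_fun /= hornerC horner0 subr0 mul1r mul0r addr0.
rewrite [LHS]/= derive1E -natr1 opprD addrA.
rewrite (@near_eq_derive _ _ _ _ (fun x => x `^ (e - j%:R) *
   type1_fun nu (rodrigues nu e j).1 (rodrigues nu e j).2 x)).
  by apply: derive_val; exact: is_derive_type1.
by near=> y; apply: IH; near: y; exact: near_gt0.
Unshelve. all: end_near. Qed.

Lemma derivable_rodrigues (e : R) (j : nat) (x : R) : 0 < x ->
  derivable (derive1n j (fun x => x `^ e * rho nu x)) x 1.
Proof.
move=> x0.
apply: (@near_eq_derivable _ _ _ (fun x => x `^ (e - j%:R) *
   type1_fun nu (rodrigues nu e j).1 (rodrigues nu e j).2 x)).
  near=> y; rewrite derive1n_rodrigues//; near: y; exact: near_gt0.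
by have [] := is_derive_type1 (e - j%:R) (rodrigues nu e j) x0.
Unshelve. all: end_near. Qed.

(** The coefficients are an arbitrary sequence so that the induction can run on
    the number of terms. *)
Lemma moment_poly (lam s : R) (n : nat) (c : nat -> R) :
  -1 < lam -> 0 < s -> 0 < s + lam ->
  let f x := \sum_(i < n) (c i * x ^+ i) * rho lam x * x `^ (s - 1) in
  mu.-integrable halfline (EFin \o f) /\
  \int[mu]_(x in halfline) f x =
  \sum_(i < n) c i * (Gam (s + i%:R) * Gam (s + i%:R + lam)).
Proof.
move=> lam1 s0 sl0; elim: n => [|n [IH1 IH2]]; cbv zeta.
  rewrite (_ : (fun x => _) = fun=> 0); last by apply/funext => x; rewrite big_ord0.
  rewrite big_ord0; split; first exact: integrable0.
  by rewrite /Rintegral integral0.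
have sn0 : 0 < s + n%:R by rewrite ltr_wpDr.
have snl0 : 0 < s + n%:R + lam by rewrite addrAC ltr_wpDr.
have hE (x : R) : 0 < x -> c n * (x `^ (s + n%:R - 1) * rho lam x) =
    (c n * x ^+ n) * rho lam x * x `^ (s - 1).
  move=> x0; rewrite addrAC [X in c n * (X * _)]powRD ?(gt_eqF x0) ?implybT//.
  by rewrite powR_mulrn ?(ltW x0)//; ring.
have i1 := integrable_halflineZ (c n) (integrable_moment lam1 sn0 snl0).
have i2 := eq_integrable_halfline hE i1.
have i3 := integrable_halflineD IH1 i2.
rewrite (_ : (fun x => _) = (fun x =>
  \sum_(i < n) (c i * x ^+ i) * rho lam x * x `^ (s - 1) +
  (c n * x ^+ n) * rho lam x * x `^ (s - 1))); last first.
  by apply/funext => x; rewrite big_ord_recr.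
split; first exact: i3.
rewrite RintegralD// IH2 big_ord_recr/=; congr (_ + _).
rewrite -(eq_Rintegral_halfline hE) RintegralZl//; last exact: integrable_moment.
by rewrite moment.
Qed.

Lemma Gam_mellinU (s : R) (i : nat) : 0 < s ->
  Gam (s + i%:R) * Gam (s + i%:R + nu) =
  Gam s * Gam (s + nu) * (mellinU nu i).[s].
Proof.
move=> s0; elim: i => [|i IH].
  by rewrite /= hornerC addr0 mulr1.
have si0 : 0 < s + i%:R by rewrite ltr_wpDr.
have sin0 : 0 < s + i%:R + nu by rewrite ltr_wpDr.
have -> : s + i.+1%:R = s + i%:R + 1 by rewrite -natr1 addrA.
rewrite (addrAC _ 1 nu) !Gam_succ//.
rewrite /= !hornerM !hornerD hornerX !hornerC.
transitivity (Gam (s + i%:R) * Gam (s + i%:R + nu) * (s + i%:R + nu) * (s + i%:R)).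
  ring.
rewrite IH; ring.
Qed.

Lemma Gam_mellinV (s : R) (i : nat) : 0 < s ->
  Gam (s + i%:R) * Gam (s + i%:R + (nu + 1)) =
  Gam s * Gam (s + nu) * (mellinV nu i).[s].
Proof.
move=> s0.
have sin0 : 0 < s + i%:R + nu by rewrite ltr_wpDr// ltr_wpDr.
rewrite addrA Gam_succ// mulrCA Gam_mellinU//.
rewrite /mellinV hornerM hornerD hornerX hornerC; ring.
Qed.

Lemma horner_expansion (W : nat -> {poly R}) (p : {poly R}) (s : R) :
  (expansion W p).[s] = \sum_(i < size p) p`_i * (W i).[s].
Proof. by rewrite /expansion horner_sum; apply: eq_bigr => i _; rewrite hornerZ. Qed.

Lemma moment_type1 (s : R) (A B : {poly R}) : 0 < s ->
  let f x := type1_fun nu A B x * x `^ (s - 1) in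
  mu.-integrable halfline (EFin \o f) /\
  \int[mu]_(x in halfline) f x = Gam s * Gam (s + nu) * (mellin nu (A, B)).[s].
Proof.
move=> s0 f.
have sn0 : 0 < s + nu by rewrite ltr_wpDr.
have sn10 : 0 < s + (nu + 1) by rewrite addrA addr_gt0.
have nu2 : -1 < nu + 1 by rewrite (lt_trans nu1)// ltrDl.
have [iA eA] := moment_poly (size A) (fun i => A`_i) nu1 s0 sn0.
have [iB eB] := moment_poly (size B) (fun i => B`_i) nu2 s0 sn10.
have fE : f = (fun x => \sum_(i < size A) (A`_i * x ^+ i) * rho nu x * x `^ (s - 1) +
   \sum_(i < size B) (B`_i * x ^+ i) * rho (nu + 1) x * x `^ (s - 1)).
  apply/funext => x; rewrite /f /type1_fun mulrDl !horner_coef.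
  by rewrite !mulr_suml; congr (_ + _); apply: eq_bigr => i _; rewrite mulrA.
rewrite fE; split; first exact: integrable_halflineD.
rewrite RintegralD// eA eB /mellin hornerD/= !horner_expansion mulrDr !mulr_sumr.
congr (_ + _); apply: eq_bigr => i _.
  by rewrite Gam_mellinU//; ring.
by rewrite Gam_mellinV//; ring.
Qed.

Variable alpha : R.
Hypothesis alpha1 : -1 < alpha.

(** The factor [Gam s * Gam (s + nu)] is positive at [s = k + alpha + 1], so the
    moment vanishes exactly when the symbol does. *)
Lemma type1_orthogonal_iff (k : nat) (A B : {poly R}) :
  (let f x := type1_fun nu A B x * x `^ (k%:R + alpha) in
   mu.-integrable halfline (EFin \o f) /\ \int[mu]_(x in halfline) f x = 0) <->
  root (mellin nu (A, B)) (k%:R + alpha + 1).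
Proof.
have k0 : 0 <= k%:R :> R by [].
have s0 : 0 < k%:R + alpha + 1 by rewrite -addrA ltr_wpDl// -ltrBlDr sub0r.
have [] := moment_type1 A B s0; rewrite addrK => i1 e1.
have g0 : Gam (k%:R + alpha + 1) * Gam (k%:R + alpha + 1 + nu) != 0.
  by apply: mulf_neq0; rewrite gt_eqF// Gam_gt0// ltr_wpDr.
split.
  by move=> [_]; rewrite e1 => /eqP; rewrite mulf_eq0 (negbTE g0).
by move=> /eqP e0; split => //; rewrite e1 e0 mulr0.
Qed.

Definition orthogonality_nodes (N : nat) := [seq k%:R + alpha + 1 | k <- iota 0 N].

Lemma uniq_nodes N : uniq (orthogonality_nodes N).
Proof.
rewrite map_inj_uniq ?iota_uniq// => i j /addIr/addIr/eqP.
by rewrite eqr_nat => /eqP.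
Qed.

Lemma mellin_rodrigues_nodes N :
  mellin nu (rodrigues nu (N%:R + alpha) N) =
  (-1) ^+ N *: \prod_(z <- orthogonality_nodes N) ('X - z%:P).
Proof.
rewrite mellin_rodrigues /orthogonality_nodes big_map -[in RHS](subn0 N) -/(index_iota 0 N).
(* Step i contributes N + alpha - i: the nodes appear in decreasing order. *)
rewrite big_mkord (reindex_inj rev_ord_inj)/=.
rewrite (eq_bigr (fun i : 'I_N => -1 * ('X - (i%:R + alpha + 1)%:P))); last first.
  move=> i _; rewrite mulN1r opprB natrB; last exact: ltn_ord.
  by congr (_%:P - _); rewrite -natr1; ring.
by rewrite big_split/= prodr_const card_ord -mul_polyC rmorphXn/= polyCN subn0.
Qed.

(** Both symbols have degree at most [N] and vanish at the [N] nodes, so both are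
    constant multiples of the product over the nodes. *)
Lemma rodrigues_unique (N : nat) (A B : {poly R}) :
  (A, B) <> (0, 0) -> (size A <= N./2.+1)%N -> (size B <= N.+1./2)%N ->
  (forall k, (k < N)%N -> root (mellin nu (A, B)) (k%:R + alpha + 1)) ->
  exists2 c : R, c != 0 & rodrigues nu (N%:R + alpha) N = (c *: A, c *: B).
Proof.
move=> AB0 sA sB rt; set P := mellin nu (A, B) in rt.
have P0 : P != 0.
  by apply/eqP => /mellin_eq0 [A0 B0]; apply: AB0; rewrite A0 B0.
have all_rt : all (root P) (orthogonality_nodes N).
  by apply/allP => z /mapP[k]; rewrite mem_iota add0n => /rt ? ->.
have szP : size P = (size (orthogonality_nodes N)).+1.
  apply/eqP; rewrite eqn_leq (max_poly_roots P0 all_rt (uniq_nodes N)) andbT.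
  by rewrite size_map size_iota; exact: size_mellin_le.
have := all_roots_prod_XsubC szP all_rt.
rewrite uniq_rootsE uniq_nodes => /(_ isT) PE.
have lc0 : lead_coef P != 0 by rewrite lead_coef_eq0.
pose c := (-1) ^+ N / lead_coef P.
have c0 : c != 0 by rewrite mulf_neq0 ?invr_eq0// signr_eq0.
exists c => //.
have := mellin_rodrigues_nodes N.
case E : (rodrigues _ _ _) => [C D] MCD.
have : mellin nu (C - c *: A, D - c *: B) = 0.
  rewrite mellinB_scale -/P PE MCD scalerA /c mulfVK//; exact: subrr.
by move=> /mellin_eq0 [/subr0_eq -> /subr0_eq ->].
Qed.

(** The symbol of the pair is a product of nonzero polynomials. *)
Lemma rodrigues_neq0 (e : R) (N : nat) : rodrigues nu e N <> (0, 0).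
Proof.
move=> r0; have := mellin_rodrigues nu e N.
rewrite r0 /mellin /expansion/= size_poly0 !big_ord0 addr0 => /esym/eqP.
rewrite prodf_seq_eq0 => /hasP[i _] /=; rewrite subr_eq0 => /eqP.
by move=> /(congr1 (fun p : {poly R} => size p)); rewrite size_polyX => h;
   have := size_polyC_leq1 (e - i%:R); rewrite h.
Qed.

(** The two formulas of the theorem are the cases [N = 2n] and [N = 2n + 1]; the
    parity of [N] only matters for the degree bounds [N./2] on [A] and
    [N.+1./2 - 1] on [B]. *)
Lemma rodrigues_type1 (N n : nat) (m : int) :
  N./2 = n -> (forall B : {poly R}, ((size B)%:Z <= m + 1) = (size B <= N.+1./2)%N) ->
  (forall k : nat, (k%:Z <= n%:Z + m) = (k < N)%N) ->
  (exists A B : {poly R}, is_type1_pair nu alpha n m A B) /\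
   (forall A B : {poly R}, is_type1_pair nu alpha n m A B ->
      exists2 c : R, c != 0 &
        is_derive1n_gt0 N
          (fun x => x `^ (N%:R + alpha) * rho nu x)
          (fun x => x `^ alpha * (c * type1_fun nu A B x))).
Proof.
move=> Nn Bm kN; split.
  exists (rodrigues nu (N%:R + alpha) N).1, (rodrigues nu (N%:R + alpha) N).2.
  have [s1 s2] := size_rodrigues nu (N%:R + alpha) N.
  have := @rodrigues_neq0 (N%:R + alpha) N.
  have := mellin_rodrigues_nodes N.
  case: (rodrigues _ _ _) s1 s2 => C D /= s1 s2 MCD CD0; split => //.
  - by rewrite -Nn.
  - by rewrite Bm.
  - move=> k; rewrite kN => kN'; apply/type1_orthogonal_iff.
    rewrite MCD rootZ ?signr_eq0// root_prod_XsubC.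
    by apply/mapP; exists k => //; rewrite mem_iota.
move=> A B [AB0 sA sB ort].
have [||k kN'|c c0 E] := @rodrigues_unique N A B AB0.
- by rewrite Nn.
- by rewrite -Bm.
- by apply/type1_orthogonal_iff; apply: ort; rewrite kN.
exists c => // x x0; split; first by move=> j _; exact: derivable_rodrigues.
rewrite derive1n_rodrigues// E /= [N%:R + _]addrC addrK; congr (_ * _).
by rewrite /type1_fun !hornerZ; ring.
Qed.

End Rodrigues.

Theorem theorem3 (R : realType) (nu : R) (hnu : 0 <= nu)
    (alpha : R) (halpha : -1 < alpha) (n : nat) :
  ((exists A B : {poly R}, is_type1_pair nu alpha n (n%:Z - 1) A B) /\
   (forall A B : {poly R}, is_type1_pair nu alpha n (n%:Z - 1) A B ->
      exists2 c : R, c != 0 &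
        is_derive1n_gt0 (2 * n)
          (fun x => x `^ ((2 * n)%:R + alpha) * rho nu x)
          (fun x => x `^ alpha * (c * type1_fun nu A B x)))) /\
  ((exists A B : {poly R}, is_type1_pair nu alpha n n%:Z A B) /\
   (forall A B : {poly R}, is_type1_pair nu alpha n n%:Z A B ->
      exists2 c : R, c != 0 &
        is_derive1n_gt0 (2 * n + 1)
          (fun x => x `^ ((2 * n + 1)%:R + alpha) * rho nu x)
          (fun x => x `^ alpha * (c * type1_fun nu A B x)))).
Proof.
split; apply: rodrigues_type1 => //.
- by lia.
- by move=> B; apply/idP/idP; lia.
- by move=> k; apply/idP/idP; lia.
- by lia.
- by move=> B; apply/idP/idP; lia.
- by move=> k; apply/idP/idP; lia.
Qed.
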